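(* Let $R$ be a commutative ring, $J\subseteq R$ an ideal, $g\in R$, and let $\mathfrak a$ be a sequence regular on $R/(J,g)$. Then $\mathfrak a$ is regular on $R/J$ if and only if $\mathfrak a$ is regular on $R/(J:g)$.
   Context: $(J,g)$ denotes the ideal $J+(g)$ and $(J:g)=\{r\in R\mid rg\in J\}$. A sequence $\mathfrak a=a_1,\dots,a_s$ in $R$ is regular on a module $N$ if each $a_i$ is a nonzerodivisor on $N/(a_1,\dots,a_{i-1})N$. *)

(* Defs.v *)
From HB Require Import structures.
From mathcomp Require Import all_boot all_algebra boolp.

Set Implicit Arguments.
Unset Strict Implicit.
Unset Printing Implicit Defensive.

Import GRing.Theory Quotient.
Local Open Scope ring_scope.
Local Open Scope quotient_scope.

Section QuotientModule.
Variables (R : pzRingType) (V : lmodType R) (S : submodClosed V).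

Fact submod_zmod_closed : zmod_closed (S : {pred V}).
Proof. by apply: GRing.submod_closedB; exact: submodClosedP. Qed.

Definition submod_zmod : zmodClosed V :=
  HB.pack_for (zmodClosed V) (S : {pred V})
    (GRing.isZmodClosed.Build V (S : {pred V}) submod_zmod_closed).

Definition quotmod : Type := {quot submod_zmod}.

HB.instance Definition _ := GRing.Zmodule.on quotmod.

Definition qscale (a : R) (x : quotmod) : quotmod :=
  \pi_({quot submod_zmod}) (a *: repr (x : {quot submod_zmod})).

Fact pi_qscale a (v : V) :
  qscale a (\pi_({quot submod_zmod}) v) = \pi_({quot submod_zmod}) (a *: v).
Proof.
rewrite /qscale; apply/eqP; rewrite -idealrBE -scalerBr.
by apply: rpredZ; rewrite -[_ \in S]/(_ \in submod_zmod) idealrBE reprK.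
Qed.

Fact qscaleA a b x : qscale a (qscale b x) = qscale (a * b) x.
Proof. by rewrite [qscale b x]/qscale pi_qscale scalerA. Qed.

Fact qscale1 : left_id 1 qscale.
Proof. by move=> x; rewrite /qscale scale1r reprK. Qed.

Fact qscaleDr : right_distributive qscale +%R.
Proof.
move=> a x y; rewrite -[x](@reprK _ {quot submod_zmod}).
rewrite -[y](@reprK _ {quot submod_zmod}).
by rewrite -[_ + _](@raddfD _ _ (\pi_({quot submod_zmod}))) !pi_qscale
  scalerDr raddfD.
Qed.

Fact qscaleDl x : {morph qscale^~ x : a b / a + b}.
Proof. by move=> a b; rewrite /qscale scalerDl raddfD. Qed.

HB.instance Definition _ :=
  GRing.Zmodule_isLmodule.Build R quotmod qscaleA qscale1 qscaleDr qscaleDl.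

End QuotientModule.

Arguments quotmod {R V} S.

(* Ideals need not be proper, so the library's [idealr] does not apply: an
   ideal of a commutative ring is a submodule of its regular module.  Subsets
   are boolean predicates; [asbool] (classical) makes any Prop one. *)
Notation ideal R := (submodClosed R^o) (only parsing).

Section Ideals.
Variable R : comPzRingType.

Definition ideal_gen (s : seq R) : {pred R^o} := fun x =>
  `[< exists c : 'I_(size s) -> R, x = \sum_(i < size s) c i * s`_i >].

Fact ideal_gen_closed s : submod_closed (ideal_gen s).
Proof.
split=> [|a x y /asboolP[c ->] /asboolP[d ->]]; apply/asboolP.
  by exists (fun=> 0); rewrite big1 // => i _; rewrite mul0r.
exists (fun i => a * c i + d i).
rewrite scaler_sumr -big_split /=; apply: eq_bigr => i _.
by rewrite mulrDl -mulrA.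
Qed.

HB.instance Definition _ s :=
  GRing.isSubmodClosed.Build R R^o (ideal_gen s) (ideal_gen_closed s).

Definition ideal_add (I J : ideal R) : {pred R^o} := fun x =>
  `[< exists u v, [/\ u \in I, v \in J & x = u + v] >].

Fact ideal_add_closed I J : submod_closed (ideal_add I J).
Proof.
split=> [|a x y /asboolP[u [v [Iu Jv ->]]] /asboolP[u' [v' [Iu' Jv' ->]]]].
  by apply/asboolP; exists 0, 0; rewrite !rpred0 addr0.
apply/asboolP; exists (a *: u + u'), (a *: v + v').
by split; rewrite ?rpredD ?rpredZ // scalerDr addrACA.
Qed.

HB.instance Definition _ I J :=
  GRing.isSubmodClosed.Build R R^o (ideal_add I J) (ideal_add_closed I J).

Definition ideal_colon (J : ideal R) (g : R) : {pred R^o} :=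
  fun r => (r * g : R^o) \in J.

Fact ideal_colon_closed J g : submod_closed (ideal_colon J g).
Proof.
split=> [|a x y Jx Jy]; rewrite -[_ \in _]/(_ * g \in (J : {pred R^o})).
  by rewrite mul0r; apply: (@rpred0 R^o).
rewrite mulrDl -[a *: x]/(a * x) -mulrA.
by apply: (@rpredD R^o) => //; apply: (@rpredZ _ R^o).
Qed.

HB.instance Definition _ J g :=
  GRing.isSubmodClosed.Build R R^o (ideal_colon J g) (ideal_colon_closed J g).

End Ideals.

Section RegularSequence.
Variables (R : comPzRingType).

Definition ideal_smul (I : ideal R) (N : lmodType R) : {pred N} := fun x =>
  `[< exists l : seq (R^o * N),
        {in l, forall p, p.1 \in I} /\ x = \sum_(p <- l) p.1 *: p.2 >].

Arguments ideal_smul : clear implicits.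

Fact ideal_smul_closed I N : submod_closed (ideal_smul I N).
Proof.
split=> [|a x y /asboolP[l [Il ->]] /asboolP[m [Im ->]]]; apply/asboolP.
  by exists [::]; rewrite big_nil.
exists ([seq (a *: p.1, p.2) | p <- l] ++ m); split.
  move=> p; rewrite mem_cat => /orP[/mapP[q lq ->]|/Im //] /=.
  by rewrite rpredZ ?Il.
rewrite big_cat big_map scaler_sumr /=; congr (_ + _).
by apply: eq_bigr => p _; rewrite scalerA.
Qed.

HB.instance Definition _ I N :=
  GRing.isSubmodClosed.Build R N (ideal_smul I N) (ideal_smul_closed I N).

Definition nonzerodivisor_on (N : lmodType R) (a : R) : Prop :=
  forall x : N, a *: x = 0 -> x = 0.

(* No condition [N <> (s) N] is imposed. *)
Definition regular_on (N : lmodType R) (s : seq R) : Prop :=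
  forall i, (i < size s)%N ->
    nonzerodivisor_on (quotmod (ideal_smul (ideal_gen (take i s)) N)) s`_i.

End RegularSequence.

(* Main.v *)
Require Import Defs.
From HB Require Import structures.
From mathcomp Require Import all_boot all_algebra boolp.

(** Write [I_i] for the ideal generated by the first [i] terms of [s].
    Regularity on [R/K] says that [s_i x] in [I_i + K] forces [x] in [I_i + K].
    Regularity on [R/(J,g)] alone yields [(I_i + J : g) = I_i + (J : g)] for all
    [i], i.e. the exact sequence [0 -> R/(J:g) -> R/J -> R/(J,g) -> 0] stays
    exact modulo [I_i]; both directions then follow by a diagram chase in it. *)

Set Implicit Arguments.
Unset Strict Implicit.
Unset Printing Implicit Defensive.

Import GRing.Theory Quotient.
Local Open Scope ring_scope.
Local Open Scope quotient_scope.

Section QuotientModule.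
Variables (R : pzRingType) (V : lmodType R) (S : submodClosed V).

Definition quotmod_pi (v : V) : quotmod S := \pi_({quot submod_zmod S}) v.

Lemma quotmod_pi_surj (x : quotmod S) : exists v, x = quotmod_pi v.
Proof. by exists (repr (x : {quot submod_zmod S})); rewrite /quotmod_pi reprK. Qed.

Lemma quotmod_piD : {morph quotmod_pi : u v / u + v}.
Proof. by move=> u v; rewrite /quotmod_pi raddfD. Qed.

Lemma quotmod_piZ a v : quotmod_pi (a *: v) = a *: quotmod_pi v.
Proof. by rewrite /quotmod_pi -pi_qscale. Qed.

Lemma quotmod_pi_eq u v : quotmod_pi u = quotmod_pi v <-> u - v \in S.
Proof.
rewrite -[_ \in S]/(_ \in submod_zmod S) idealrBE.
by split=> [/eqP|/eqP].
Qed.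

Lemma quotmod_pi_eq0 v : quotmod_pi v = 0 <-> v \in S.
Proof.
have -> : 0 = quotmod_pi 0 by rewrite /quotmod_pi raddf0.
by rewrite quotmod_pi_eq subr0.
Qed.

End QuotientModule.

Section Ideals.
Variable R : comPzRingType.
Implicit Types (I J K : ideal R) (s : seq R) (a g : R) (x y : R^o).

Lemma ideal_mull I a x : x \in I -> (a * x : R^o) \in I.
Proof. exact: (@rpredZ _ R^o). Qed.

Lemma ideal_addP I J x :
  reflect (exists u v, [/\ u \in I, v \in J & x = u + v]) (x \in ideal_add I J).
Proof. exact: asboolP. Qed.

Lemma mem_ideal_addr I J x : x \in J -> x \in ideal_add I J.
Proof. by move=> Jx; apply/ideal_addP; exists 0, x; rewrite rpred0 add0r. Qed.

Lemma ideal_gen_rconsP s a x :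
  x \in ideal_gen (rcons s a) <->
  exists y (c : R), y \in ideal_gen s /\ x = y + c * a.
Proof.
split=> [/asboolP[c ->]|[y [c [/asboolP[d ->] ->]]]].
  move: c; rewrite size_rcons => c; rewrite big_ord_recr /= nth_rcons ltnn eqxx.
  exists (\sum_(i < size s) c (widen_ord (leqnSn _) i) * s`_i), (c ord_max).
  split; first by apply/asboolP; exists (fun i => c (widen_ord (leqnSn _) i)).
  by congr (_ + _); apply: eq_bigr => i _; rewrite nth_rcons ltn_ord.
apply/asboolP; rewrite size_rcons.
(* [insub] succeeds exactly on the indices below [size s], so the last index receives [c]. *)
exists (fun i => if insub (val i) is Some j then d j else c).
rewrite big_ord_recr /= nth_rcons ltnn eqxx insubN ?ltnn //.
by congr (_ + _); apply: eq_bigr => i _; rewrite nth_rcons ltn_ord valK.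
Qed.

Lemma ideal_gen1P g x : x \in ideal_gen [:: g] <-> exists c : R, x = c * g.
Proof.
rewrite -[[:: g]]/(rcons [::] g) ideal_gen_rconsP; split.
  by case=> y [c [/asboolP[d ->] ->]]; exists c; rewrite big_ord0 add0r.
by case=> c ->; exists 0, c; rewrite rpred0 add0r.
Qed.

(** As [R/K] is generated by the class of 1, each term of a sum in [I (R/K)] is the class of an
    element of [I]. Hence [I (R/K)] is the image of [I + K]. *)
Lemma mem_ideal_smul_quotmod I K x :
  quotmod_pi K x \in ideal_smul (N := quotmod K) I <-> x \in ideal_add I K.
Proof.
split=> [/asboolP[l [Il]]|/ideal_addP[u [v [Iu Kv ->]]]].
  suff [y [Iy ->]] : exists y : R^o,
      y \in I /\ \sum_(p <- l) p.1 *: p.2 = quotmod_pi K y.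
    rewrite quotmod_pi_eq => Kxy; apply/ideal_addP; exists y, (x - y).
    by rewrite [y + _]addrC subrK.
  elim: l Il => [|[c z] l IHl] Il.
    exists 0; rewrite rpred0 big_nil; split=> //.
    by apply/esym/quotmod_pi_eq0; exact: rpred0.
  have [p lp|y [Iy yE]] := IHl; first by apply: Il; rewrite inE lp orbT.
  have [v ->] := quotmod_pi_surj z.
  exists (v * c + y); split.
    by apply: (@rpredD R^o) => //; apply/ideal_mull/(Il (c, z))/mem_head.
  by rewrite big_cons yE quotmod_piD mulrC -quotmod_piZ.
apply/asboolP; exists [:: (u, quotmod_pi K 1)]; split.
  by move=> p; rewrite inE => /eqP->.
rewrite big_seq1 /= -quotmod_piZ quotmod_pi_eq.
by rewrite [u *: _]mulr1 addrAC subrr add0r.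
Qed.

Lemma regular_on_quotP K s :
  regular_on (quotmod K) s <->
  forall i, (i < size s)%N -> forall x,
    (s`_i * x : R^o) \in ideal_add (ideal_gen (take i s)) K ->
    x \in ideal_add (ideal_gen (take i s)) K.
Proof.
split=> reg i lt_is x.
  rewrite -!mem_ideal_smul_quotmod -!quotmod_pi_eq0 !quotmod_piZ.
  exact: reg.
(* [x] lies in a quotient of [R/K], so it is lifted twice: to [R/K], then to [R]. *)
have [y ->] := quotmod_pi_surj x; have [z ->] := quotmod_pi_surj y.
rewrite -!quotmod_piZ !quotmod_pi_eq0 !mem_ideal_smul_quotmod.
exact: reg.
Qed.

(** Multiplication by [g] sends [(J:g)] into [J] and [I] into itself, so it induces a map from
    [R/(I + (J:g))] to [R/(I + J)]. *)
Lemma mem_ideal_add_colon I J g x :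
  x \in ideal_add I (ideal_colon J g) -> (x * g : R^o) \in ideal_add I J.
Proof.
case/ideal_addP=> u [v [Iu Jv ->]]; apply/ideal_addP; exists (u * g), (v * g).
by split; rewrite ?mulrDl // mulrC; apply: ideal_mull.
Qed.

Lemma ideal_add_add_gen1 I J g x :
  x \in ideal_add I (ideal_add J (ideal_gen [:: g])) <->
  exists y (c : R), y \in ideal_add I J /\ x = y + c * g.
Proof.
split=> [/ideal_addP[u [_ [Iu /ideal_addP[v [w [Jv gw ->]]] ->]]]|].
  have [c ->] := (ideal_gen1P g w).1 gw.
  exists (u + v), c; rewrite addrA; split=> //.
  by apply/ideal_addP; exists u, v.
case=> _ [c [/ideal_addP[u [v [Iu Jv ->]]] ->]].
apply/ideal_addP; exists u, (v + c * g); rewrite addrA; split=> //.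
by apply/ideal_addP; exists v, (c * g); split=> //; apply/ideal_gen1P; exists c.
Qed.

(** The map induced by [g] is injective modulo [I_i]. By induction on [i]: subtracting a suitable
    multiple of the last generator from [x] brings the product with [g] down to the previous
    ideal. *)
Lemma regular_ideal_add_colon J g s i x :
  regular_on (quotmod (ideal_add J (ideal_gen [:: g]))) s -> (i <= size s)%N ->
  (x * g : R^o) \in ideal_add (ideal_gen (take i s)) J ->
  x \in ideal_add (ideal_gen (take i s)) (ideal_colon J g).
Proof.
move/regular_on_quotP=> reg; elim: i x => [|i IHi] x lt_is.
  rewrite take0 => /ideal_addP[u [v [/asboolP[c ->] Jv xg]]].
  by apply: mem_ideal_addr; rewrite big_ord0 add0r in xg; rewrite unfold_in /= xg.
rewrite (take_nth 0 lt_is) => /ideal_addP[u [v [su Jv xg]]].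
have [y [c [sy uE]]] := (ideal_gen_rconsP _ _ _).1 su.
have syv : (y + v : R^o) \in ideal_add (ideal_gen (take i s)) J.
  by apply/ideal_addP; exists y, v.
(* Since [s_i c = -(y + v) + x g], regularity modulo [(J,g)] puts the coefficient [c] itself in
   [I_i + J + (g)]. *)
have [|z [d [sz cE]]] := (ideal_add_add_gen1 (ideal_gen (take i s)) J g c).1.
  apply: reg => //; apply/ideal_add_add_gen1; exists (- (y + v)), x.
  by rewrite rpredN xg uE; split=> //; rewrite addrAC addrA addNr add0r mulrC.
(* Substituting [c = z + d g] into [x g = y + c s_i + v] moves [d s_i g] to the left. *)
have : x - d * s`_i \in ideal_add (ideal_gen (take i s)) (ideal_colon J g).
  apply: IHi; first exact: ltnW.
  have -> : (x - d * s`_i) * g = (y + v) + s`_i * z.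
    rewrite mulrBl xg uE cE mulrDl mulrAC [z * _]mulrC addrAC -!addrA.
    by rewrite (addrA (d * _ * _)) subrr add0r [v + _]addrC.
  by apply: (@rpredD R^o) => //; apply: ideal_mull.
case/ideal_addP=> w [t [sw Jt xE]]; apply/ideal_addP.
exists (w + d * s`_i), t; split=> //; first by apply/ideal_gen_rconsP; exists w, d.
by rewrite addrAC -xE subrK.
Qed.

End Ideals.

Theorem lemma5p3 (R : comPzRingType) (J : ideal R) (g : R)
    (s : seq R) :
  regular_on (quotmod (ideal_add J (ideal_gen [:: g]))) s ->
  (regular_on (quotmod J) s <-> regular_on (quotmod (ideal_colon J g)) s).
Proof.
move=> regJg; have /regular_on_quotP regC := regJg.
rewrite !regular_on_quotP; split=> reg i lt_is x sx.
  (* Multiply by [g] to pass to [I_i + J], cancel [s_i] there, then divide by [g] again. *)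
  apply: (regular_ideal_add_colon regJg (ltnW lt_is)); apply: reg => //.
  by rewrite mulrA; apply: mem_ideal_add_colon.
(* Cancelling [s_i] modulo [(J,g)] gives [x = y + c g] with [y] in [I_i + J]. It remains to treat
   [c g], for which cancelling [s_i] from [s_i c] modulo [I_i + (J:g)] suffices. *)
have [|y [c [sy xE]]] := (ideal_add_add_gen1 (ideal_gen (take i s)) J g x).1.
  by apply: regC => //; apply/ideal_add_add_gen1; exists (s`_i * x), 0;
    rewrite mul0r addr0.
rewrite xE; apply: (@rpredD R^o) => //; apply/mem_ideal_add_colon/reg => //.
apply: (regular_ideal_add_colon regJg (ltnW lt_is)).
have -> : s`_i * c * g = s`_i * x - s`_i * y.
  by rewrite xE mulrDr addrAC subrr add0r mulrA.
by apply: (@rpredB R^o) => //; apply: ideal_mull.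
Qed.
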